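(* Let $P$ be a positive recurrent transition matrix of $M/G/1$ type with $r\times r$ blocks $B_k$ ($k\ge 0$) and $A_k$ ($k\ge -1$), let $N\ge 0$, and partition $P$ according to $L_{\le N}$ and $L_{\le N}^c$ into $T_N,\,U_N,\,D_N,\,Q$, the levels $N+1,N+2,\dots$ of $L_{\le N}^c$ being renumbered $0,1,2,\dots$ (so $Q_{i,t}=A_{t-i}$ with $A_k=0$ for $k<-1$, and $D=D_N$ has the single nonzero block $D_{0,N}=A_{-1}$). Then for $m=0$, $$(Q^0D)_{i,N}=\mathbf 1_{\{i=0\}}A_{-1}\qquad (i\ge 0).$$ For integers $m\ge 1$ and $i\ge 0$, put $\ell_0=i$, $\ell_u=i+\sum_{j=1}^u k_j$ ($1\le u\le m$), and $$\mathcal K_m(i)=\Bigl\{(k_1,\dots,k_m)\in\{-1,0,1,2,\dots\}^m \ \Bigm|\ \ell_u\ge 0\ (0\le u\le m),\ \ell_m=0\Bigr\}.$$ Then $$(Q^mD)_{i,N}=\sum_{(k_1,\dots,k_m)\in\mathcal K_m(i)}A_{k_1}\cdots A_{k_m}A_{-1},$$ with $(Q^mD)_{i,N}=0$ whenever $i>m$. Consequently, with $\hat Q=\sum_{m=0}^\infty Q^m$, $$(\hat QD)_{i,N}=\sum_{m=0}^\infty (Q^mD)_{i,N}=\mathbf 1_{\{i=0\}}A_{-1}+\sum_{m=1}^\infty\ \sum_{(k_1,\dots,k_m)\in\mathcal K_m(i)}A_{k_1}\cdots A_{k_m}A_{-1},\qquad i\ge 0,$$ and the transition matrix $P^{(N)}$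 of the Markov chain censored to $L_{\le N}$ is given explicitly by $P^{(N)}=T_N+U_N\hat QD_N$ with this expression for $\hat Q D_N$.
   Context: Fix an integer $r\ge1$. The state space is $S=\bigcup_{i\ge0}L_i$ with levels $L_i=\{(i,\alpha):\alpha=1,\dots,r\}$; $L_{\le N}=\bigcup_{i=0}^N L_i$ and $L_{\le N}^c=S\setminus L_{\le N}$. A transition (stochastic) matrix $P=(P_{i,j})_{i,j\ge0}$ with $r\times r$ blocks is of $M/G/1$ type if $P_{0,j}=B_j$ for $j\ge0$, $P_{i,j}=A_{j-i}$ for $i\ge1$, $j\ge i-1$, and $P_{i,j}=0$ otherwise, where $B_k$ ($k\ge 0$), $A_k$ ($k\ge -1$) are nonnegative $r\times r$ matrices; set $A_k=0$ for $k<-1$. Partition: $P=\begin{pmatrix}T_N&U_N\\ D_N&Q\end{pmatrix}$ according to $L_{\le N}$ and $L_{\le N}^c$. With complement levels $N+1,N+2,\dots$ renumbered $0,1,\dots$: $Q_{i,t}=A_{t-i}$ ($i,t\ge0$); $(U_N)_{0,s}=B_{N+1+s}$ and $(U_N)_{i,s}=A_{N+1+s-i}$ for $1\le i\le N$, $s\ge0$; $D_N$ has all blocks zero except $(D_N)_{0,N}=A_{-1}$. The censored chain on $L_{\le N}$ is the chain obtained by observing the original chain only at its successive visits to $L_{\le N}$; its transition matrix is denoted $P^{(N)}$. *)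

(* Defs.v *)
From HB Require Import structures.
From mathcomp Require Import all_boot all_order all_algebra.
From mathcomp Require Import all_classical all_reals all_analysis.

Set Implicit Arguments.
Unset Strict Implicit.
Unset Printing Implicit Defensive.

Import Order.TTheory GRing.Theory Num.Theory.

Local Open Scope classical_set_scope.
Local Open Scope ring_scope.
Local Open Scope ereal_scope.

(** ** Infinite nonnegative matrices

    Entries live in [\bar R] and products are unconditional sums ([esum], which
    is meaningful for nonnegative terms), so that powers and the series
    [Qhat = \sum_m Q ^ m] need no convergence side condition. *)

Definition imx (R : realType) (E F : Type) := E -> F -> \bar R.

Definition imx_id (R : realType) (E : eqType) : imx R E E :=
  fun x y => (x == y)%:R%:E.

Definition imx_add (R : realType) (E F : Type) (M M' : imx R E F) : imx R E F :=
  fun x y => M x y + M' x y.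

Definition imx_mul (R : realType) (E : Type) (F : choiceType) (G : Type)
    (M : imx R E F) (M' : imx R F G) : imx R E G :=
  fun x z => \esum_(y in [set: F]) (M x y * M' y z).

Fixpoint imx_pow (R : realType) (E : choiceType) (M : imx R E E) (m : nat) :
    imx R E E :=
  if m is m'.+1 then imx_mul (imx_pow M m') M else @imx_id R E.

Definition imx_hat (R : realType) (E : choiceType) (M : imx R E E) : imx R E E :=
  fun x y => \sum_(0 <= m <oo) imx_pow M m x y.

(** ** Transition matrices and positive recurrence *)

Definition transition_matrix (R : realType) (E : choiceType) (K : imx R E E) :=
  (forall x y, 0 <= K x y) /\ (forall x, \esum_(y in [set: E]) K x y = 1).

(* [first_passage K n x y] is the probability that the chain started at [x]
   visits [y] at time [n.+1] and at none of the times 1, ..., n. *)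
Fixpoint first_passage (R : realType) (E : choiceType) (K : imx R E E)
    (n : nat) : imx R E E :=
  if n is n'.+1
  then fun x y => \esum_(z in [set z | z != y]) (K x z * first_passage K n' z y)
  else K.

(* Every state is recurrent with finite mean return time. Irreducibility is not
   part of the definition. *)
Definition positive_recurrent (R : realType) (E : choiceType) (K : imx R E E) :=
  forall x, \sum_(0 <= n <oo) first_passage K n x x = 1 /\
            \sum_(0 <= n <oo) (n.+1%:R%:E * first_passage K n x x) < +oo.

(** ** Markov chains and the censored chain *)

(* A process takes values in [option E]; [Z n w = None] means that the process
   has no [n]-th state on the outcome [w]. The condition below together with
   stochasticity of [K] forces [Z n.+1] to be defined almost surely wherever
   [Z n] is. The initial distribution is arbitrary. *)
Definition markov_chain (R : realType) (d : measure_display)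
    (Omega : measurableType d) (Pr : probability Omega R) (E : choiceType)
    (K : imx R E E) (Z : nat -> Omega -> option E) :=
  [/\ transition_matrix K,
      forall n x, measurable [set w | Z n w = Some x] &
      forall n (x : nat -> E),
        Pr [set w | forall i, (i <= n.+1)%N -> Z i w = Some (x i)] =
        Pr [set w | forall i, (i <= n)%N -> Z i w = Some (x i)]
          * K (x n) (x n.+1)].

(* [(i, alpha)] is phase [alpha] of level [i]; phases are numbered from 0. *)
Definition state (r : nat) := (nat * 'I_r)%type.

(* The states of levels 0, ..., N. *)
Definition low_state (r N : nat) := ('I_N.+1 * 'I_r)%type.

Definition low (r N : nat) (u : low_state r N) : state r := (val u.1, u.2).

(* The states of levels > N, level [N.+1 + i] being renumbered [i]. *)
Definition high (r N : nat) (u : state r) : state r := ((N.+1 + u.1)%N, u.2).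

(* [n] is the time of the [k]-th visit (counting from 0) of the trajectory [z]
   to levels <= N; time 0 counts as a visit if [z] starts there. *)
Definition is_visit (r N : nat) (z : nat -> state r) (k n : nat) : bool :=
  ((z n).1 <= N)%N && (count (fun j => (z j).1 <= N)%N (iota 0 n) == k).

Definition censored (r N : nat) (Omega : Type) (X : nat -> Omega -> state r)
    (k : nat) (w : Omega) : option (low_state r N) :=
  match pselect (exists n, is_visit N (X ^~ w) k n) with
  | left visited => let n := ex_minn visited in
                    Some (inord (X n w).1, (X n w).2)
  | right _ => None
  end.

(* [K] is the transition matrix P^(N): whenever a chain [X] on any probability
   space has transition matrix [P], the chain formed by its successive visits
   to levels <= N has transition matrix [K]. *)
Definition is_censored_matrix (R : realType) (r N : nat)
    (P : imx R (state r) (state r))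
    (K : imx R (low_state r N) (low_state r N)) :=
  forall (d : measure_display) (Omega : measurableType d)
    (Pr : probability Omega R) (X : nat -> Omega -> state r),
    markov_chain Pr P (fun n w => Some (X n w)) ->
    markov_chain Pr K (censored N X).

(** ** Matrices of M/G/1 type *)

Definition mg1_block (R : realType) (r : nat) (B : nat -> 'M[R]_r)
    (A : int -> 'M[R]_r) (i j : nat) : 'M[R]_r :=
  if i == 0%N then B j
  else if (i <= j.+1)%N then A (j%:Z - i%:Z)%R else 0%R.

Definition mg1 (R : realType) (r : nat) (B : nat -> 'M[R]_r)
    (A : int -> 'M[R]_r) : imx R (state r) (state r) :=
  fun x y => (mg1_block B A x.1 y.1 x.2 y.2)%:E.

Section Partition.
Variables (R : realType) (r N : nat) (P : imx R (state r) (state r)).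

Definition T_part : imx R (low_state r N) (low_state r N) :=
  fun u v => P (low u) (low v).
Definition U_part : imx R (low_state r N) (state r) :=
  fun u v => P (low u) (high N v).
Definition D_part : imx R (state r) (low_state r N) :=
  fun u v => P (high N u) (low v).
Definition Q_part : imx R (state r) (state r) :=
  fun u v => P (high N u) (high N v).

End Partition.

Arguments T_part {R r} N P _ _.
Arguments U_part {R r} N P _ _.
Arguments D_part {R r} N P _ _.
Arguments Q_part {R r} N P _ _.

(** ** Skip-free paths *)

(* The level l_u = i + k_1 + ... + k_u; the component [tnth k j] of the tuple
   is k_(j+1). *)
Definition path_level (i m : nat) (k : m.-tuple int) (u : nat) : int :=
  (i%:Z + \sum_(j < m | (j < u)%N) tnth k j)%R.

Definition path_set (m i : nat) : set (m.-tuple int) :=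
  [set k | [/\ forall j, (- 1 <= tnth k j)%R,
               forall u, (u <= m)%N -> (0 <= path_level i k u)%R &
               path_level i k m = 0%R]].

Arguments path_set : clear implicits.

Definition path_prod (R : realType) (r : nat) (A : int -> 'M[R]_r) (m : nat)
    (k : m.-tuple int) : 'M[R]_r :=
  ((\prod_(j < m) A (tnth k j)) *m A (- 1))%R.

(* Main.v *)
Require Import Defs.
From HB Require Import structures.
From mathcomp Require Import all_boot all_order all_algebra.
From mathcomp Require Import all_classical all_reals all_analysis.
From mathcomp Require Import zify.

Set Implicit Arguments.
Unset Strict Implicit.
Unset Printing Implicit Defensive.

Import Order.TTheory GRing.Theory Num.Theory.

Local Open Scope classical_set_scope.
Local Open Scope ring_scope.
Local Open Scope ereal_scope.

(** Reading the blocks of [P] off the partition is index bookkeeping, and the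
    formula for [Q ^ m D] is the expansion of a matrix power over trajectories:
    an entry of [Q ^ m] sums the products of transition probabilities over the
    sequences of [m] steps that keep the renumbered level nonnegative
    ([imx_pow_path]), and multiplying by [D] keeps those that end in level 0
    ([imx_pow_D_path]). Since the steps are at least -1, there are none when
    [i > m]. All terms are nonnegative, so sums may be exchanged freely; this
    gives associativity of products ([imx_mulA]) and lets [Qhat D] be computed
    term by term ([imx_mul_seriesl]).

    For the censored chain, cut the trajectory between two successive visits to
    the low levels according to the number [m] of steps spent high: [m = 0]
    contributes [T] and [m > 0] contributes [U Q ^ (m - 1) D]. Applying the
    Markov property at the time of a visit requires events that depend on the
    whole past, not only on one prescribed trajectory; such events are countable
    disjoint unions of trajectory cells, which gives [markov_step]. Iterating
    it along a high excursion ([stay_high_return]) and summing over the time of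
    the visit and the length of the excursion gives [censored_markov_step].

    That [T + U Qhat D] is stochastic expresses that the chain almost surely
    comes back to the low levels. The probability of being still high after
    [M + 1] steps from [u] is [U Q ^ M 1]; it is at most the probability of not
    having come back to [u] itself ([high_le_avoid]), which tends to 0 because
    [u] is recurrent ([censored_transition_matrix]). *)

(** * Unconditional sums of nonnegative families *)

Lemma esum_restrict (R : realType) (T : choiceType) (I J : set T)
    (a : T -> \bar R) :
  I `<=` J -> (forall x, J x -> ~ I x -> a x = 0) ->
  \esum_(i in J) a i = \esum_(i in I) a i.
Proof.
move=> IJ a0; rewrite esum_mkcond [RHS]esum_mkcond; apply: eq_esum => x _.
case: ifPn => [/set_mem Jx|xJ]; case: ifPn => // xI.
- by apply: a0 => // /mem_set; apply/negP.
- by move: xJ; rewrite notin_setE => -[]; exact/IJ/set_mem.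
Qed.

Lemma esum_single (R : realType) (T : choiceType) (a : T -> \bar R) t :
  0 <= a t -> (forall x, x != t -> a x = 0) ->
  \esum_(i in [set: T]) a i = a t.
Proof.
move=> at0 a0; rewrite -(esum_set1 at0); apply: esum_restrict => // x _ xt.
by apply: a0; apply/eqP.
Qed.

Lemma esum_fin (R : realType) (T : finType) (a : T -> \bar R) :
  (forall i, 0 <= a i) -> \esum_(i in [set: T]) a i = \sum_i a i.
Proof.
move=> a0; rewrite esum_fset//; last exact: finite_finset.
rewrite (fsbigE (index_enum T)) ?index_enum_uniq//.
  by apply: eq_bigl => i; rewrite in_setT.
by move=> i _; rewrite mem_index_enum.
Qed.

(** The factor may be [+oo]: it then acts on both sides as the indicator, with
    values 0 and [+oo], of a nonzero sum. *)
Lemma ge0_esumZl (R : realType) (T : choiceType) (I : set T) (c : \bar R)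
    (a : T -> \bar R) : 0 <= c -> (forall i, 0 <= a i) ->
  \esum_(i in I) (c * a i) = c * \esum_(i in I) a i.
Proof.
have scale_le (c' : \bar R) (a' : T -> \bar R) :
    0 <= c' -> (forall i, 0 <= a' i) ->
    \esum_(i in I) (c' * a' i) <= c' * \esum_(i in I) a' i.
  move=> c0 a0; apply: ge_ereal_sup => _ [X [finX XI] <-].
  rewrite -ge0_mule_fsumr//; apply: lee_wpmul2l => //.
  by apply: ereal_sup_ubound; exists X.
move=> c0 a0; apply/eqP; rewrite eq_le scale_le//=.
case: c c0 => [c| |//]; rewrite ?lee_fin => c0.
- have [->|c_neq0] := eqVneq c 0%R.
    by rewrite mul0e; apply: esum_ge0 => i _; rewrite mul0e.
  have c_gt0 : (0 < c)%R by rewrite lt0r c_neq0.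
  rewrite -lee_pdivlMl//; have := @scale_le (c^-1)%:E (fun i => c%:E * a i).
  rewrite (_ : \esum_(i in I) ((c^-1)%:E * (c%:E * a i)) = \esum_(i in I) a i).
    by apply => [|i]; [rewrite lee_fin invr_ge0|rewrite mule_ge0// lee_fin].
  by apply: eq_esum => i _; rewrite muleA -EFinM mulVf// mul1e.
- have [->|] := eqVneq (\esum_(i in I) a i) 0.
    by rewrite mule0; apply: esum_ge0 => i _; rewrite mule_ge0.
  move=> sum_neq0; have [i [Ii ai0]] : exists i, I i /\ a i != 0.
    apply: contrapT => no; move/eqP: sum_neq0; apply; apply: esum1 => i Ii.
    by apply/eqP/negPn/negP => ai; apply: no; exists i.
  rewrite [leRHS](esumID [set i])//; last by move=> j _; rewrite mule_ge0.
  have -> : I `&` [set i] = [set i] by apply/seteqP; split=> [j []//|j ->].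
  have oo (b : \bar R) : 0 <= b -> b != 0 -> +oo * b = +oo.
    by move=> b0 b_neq0; rewrite gt0_mulye// lt0e b_neq0.
  rewrite esum_set1 ?mule_ge0// [X in X + _]oo//.
  rewrite addye ?leey// gt_eqF// (@lt_le_trans _ _ 0)//.
  by apply: esum_ge0 => j _; rewrite mule_ge0.
Qed.

Lemma ge0_esumZr (R : realType) (T : choiceType) (I : set T) (c : \bar R)
    (a : T -> \bar R) : 0 <= c -> (forall i, 0 <= a i) ->
  \esum_(i in I) (a i * c) = (\esum_(i in I) a i) * c.
Proof.
by move=> c0 a0; rewrite muleC -ge0_esumZl//; apply: eq_esum => i _; rewrite muleC.
Qed.

Lemma exchange_esum (R : realType) (T1 T2 : choiceType) (I : set T1)
    (J : set T2) (a : T1 -> T2 -> \bar R) : (forall i j, 0 <= a i j) ->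
  \esum_(i in I) \esum_(j in J) a i j = \esum_(j in J) \esum_(i in I) a i j.
Proof.
move=> a0; rewrite !esum_esum//.
rewrite (reindex_esum (J `*`` fun=> I) _ (fun x => (x.2, x.1)))//; split=> //=.
- by move=> [i j] [].
- by move=> [i1 i2] [j1 j2] /= _ _ [] -> ->.
- by move=> [i1 i2] [Pi1 Qi2] /=; exists (i2, i1).
Qed.

Lemma esum_pair (R : realType) (T1 T2 : choiceType)
    (a : T1 * T2 -> \bar R) : (forall x, 0 <= a x) ->
  \esum_(x in [set: T1 * T2]) a x =
  \esum_(i in [set: T1]) \esum_(j in [set: T2]) a (i, j).
Proof.
move=> a0; rewrite esum_esum//.
by congr esum; [apply/seteqP; split => -[]|apply/funext => -[]].
Qed.

(** * Nonnegative matrix calculus *)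

Definition imx_ge0 (R : realType) (E F : Type) (M : imx R E F) :=
  forall x y, 0 <= M x y.

Lemma imx_mul_ge0 (R : realType) (E : Type) (F : choiceType) (G : Type)
    (M : imx R E F) (M' : imx R F G) :
  imx_ge0 M -> imx_ge0 M' -> imx_ge0 (imx_mul M M').
Proof. by move=> M0 M'0 x z; apply: esum_ge0 => y _; exact: mule_ge0. Qed.

Lemma imx_mulA (R : realType) (E : Type) (F G : choiceType) (H : Type)
    (M : imx R E F) (M' : imx R F G) (M'' : imx R G H) :
  imx_ge0 M -> imx_ge0 M' -> imx_ge0 M'' ->
  imx_mul M (imx_mul M' M'') = imx_mul (imx_mul M M') M''.
Proof.
move=> M0 M'0 M''0; apply/funext => x; apply/funext => t; rewrite /imx_mul.
transitivity (\esum_(y in [set: F]) \esum_(z in [set: G])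
    (M x y * (M' y z * M'' z t))).
  by apply: eq_esum => y _; rewrite ge0_esumZl// => z; exact: mule_ge0.
rewrite exchange_esum; last by move=> y z; rewrite !mule_ge0.
apply: eq_esum => z _; rewrite -ge0_esumZr//; last by move=> y; exact: mule_ge0.
by apply: eq_esum => y _; rewrite muleA.
Qed.

Lemma imx_id_ge0 (R : realType) (E : eqType) : imx_ge0 (@imx_id R E).
Proof. by move=> x y; rewrite lee_fin. Qed.

Lemma imx_mul1l (R : realType) (E : choiceType) (G : Type) (M : imx R E G) :
  imx_ge0 M -> imx_mul (@imx_id R E) M = M.
Proof.
move=> M0; apply/funext => x; apply/funext => z.
rewrite /imx_mul (@esum_single _ _ _ x); first by rewrite /imx_id eqxx mul1e.
- by rewrite mule_ge0// imx_id_ge0.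
- by move=> y /negPf yx; rewrite /imx_id eq_sym yx mul0e.
Qed.

Lemma imx_mul1r (R : realType) (E : Type) (F : choiceType) (M : imx R E F) :
  imx_ge0 M -> imx_mul M (@imx_id R F) = M.
Proof.
move=> M0; apply/funext => x; apply/funext => z.
rewrite /imx_mul (@esum_single _ _ _ z); first by rewrite /imx_id eqxx mule1.
- by rewrite mule_ge0// imx_id_ge0.
- by move=> y /negPf yx; rewrite /imx_id yx mule0.
Qed.

Lemma imx_pow_ge0 (R : realType) (E : choiceType) (M : imx R E E) m :
  imx_ge0 M -> imx_ge0 (imx_pow M m).
Proof.
by move=> M0; elim: m => [|m IHm]; [exact: imx_id_ge0|exact: imx_mul_ge0].
Qed.

Lemma imx_powSl (R : realType) (E : choiceType) (M : imx R E E) m :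
  imx_ge0 M -> imx_pow M m.+1 = imx_mul M (imx_pow M m).
Proof.
move=> M0; elim: m => [|m IHm]; first by rewrite /= imx_mul1l// imx_mul1r.
by rewrite -[LHS]/(imx_mul (imx_pow M m.+1) M) [in LHS]IHm -imx_mulA//; exact: imx_pow_ge0.
Qed.

Lemma imx_hat_ge0 (R : realType) (E : choiceType) (M : imx R E E) :
  imx_ge0 M -> imx_ge0 (imx_hat M).
Proof. by move=> M0 x y; apply: nneseries_ge0 => n _ _; exact: imx_pow_ge0. Qed.

Lemma imx_mul_seriesr (R : realType) (E : Type) (F : choiceType) (G : Type)
    (M : imx R E F) (M' : nat -> imx R F G) x z :
  imx_ge0 M -> (forall m, imx_ge0 (M' m)) ->
  imx_mul M (fun y z => \sum_(0 <= m <oo) M' m y z) x z =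
  \sum_(0 <= m <oo) imx_mul M (M' m) x z.
Proof.
move=> M0 M'0; rewrite nneseries_esumT; last first.
  by move=> m; apply: imx_mul_ge0.
rewrite /imx_mul exchange_esum; last first.
  by move=> m y; rewrite mule_ge0//; exact: M'0.
apply: eq_esum => y _; rewrite nneseries_esumT; last by move=> m; exact: M'0.
by rewrite ge0_esumZl// => m; exact: M'0.
Qed.

Lemma imx_mul_seriesl (R : realType) (E : Type) (F : choiceType) (G : Type)
    (M : nat -> imx R E F) (M' : imx R F G) x z :
  (forall m, imx_ge0 (M m)) -> imx_ge0 M' ->
  imx_mul (fun x y => \sum_(0 <= m <oo) M m x y) M' x z =
  \sum_(0 <= m <oo) imx_mul (M m) M' x z.
Proof.
move=> M0 M'0; rewrite nneseries_esumT; last first.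
  by move=> m; apply: imx_mul_ge0.
rewrite /imx_mul exchange_esum; last by move=> m y; rewrite mule_ge0//; exact: M0.
apply: eq_esum => y _; rewrite nneseries_esumT; last by move=> m; exact: M0.
by rewrite ge0_esumZr// => m; exact: M0.
Qed.

(** * Powers of Q as sums over skip-free paths *)

Lemma mg1_Q_block (R : realType) (r N : nat) (B : nat -> 'M[R]_r)
    (A : int -> 'M[R]_r) (A_skip_free : forall k : int, (k < - 1)%R -> A k = 0%R)
    (i t : nat) (a b : 'I_r) :
  Q_part N (mg1 B A) (i, a) (t, b) = (A (t%:Z - i%:Z)%R a b)%:E.
Proof.
rewrite /Q_part /mg1 /mg1_block /high /= addSn.
case: leqP => [it|_]; first by rewrite A_skip_free//; lia.
by congr (fun_of_matrix (A _) a b)%:E; lia.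
Qed.

Lemma mg1_D_block (R : realType) (r N : nat) (B : nat -> 'M[R]_r)
    (A : int -> 'M[R]_r) (i : nat) (j : 'I_N.+1) (a b : 'I_r) :
  D_part N (mg1 B A) (i, a) (j, b) =
  if (i == 0%N) && (j == ord_max) then (A (- 1)%R a b)%:E else 0.
Proof.
rewrite /D_part /mg1 /mg1_block /high /low /= addSn.
have jN := ltn_ord j; rewrite -(inj_eq val_inj) /=.
case: leqP => ij.
  by case: ifPn => [/andP[/eqP i0 /eqP jN']|_]; [lia|rewrite mxE].
have -> : i = 0%N by lia.
have -> : (nat_of_ord j = N)%N by lia.
by rewrite !eqxx; congr (fun_of_matrix (A _) a b)%:E; lia.
Qed.

(** The variant of [path_set] with an arbitrary final level and unrestricted
    steps, for which removing the first step is a bijection. *)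
Definition level_paths (m i t : nat) : set (m.-tuple int) :=
  [set k | (forall u, (u <= m)%N -> (0 <= path_level i k u)%R) /\
           path_level i k m = t%:Z].

Arguments level_paths : clear implicits.

Lemma path_level0 (m i : nat) (k : m.-tuple int) : path_level i k 0 = i%:Z.
Proof. by rewrite /path_level big_pred0 ?addr0. Qed.

Lemma path_level_cons (m i s u : nat) (k : m.-tuple int) :
  path_level i [tuple of (s%:Z - i%:Z)%R :: k] u.+1 = path_level s k u.
Proof.
rewrite /path_level big_mkcond big_ord_recl /= tnth0 addrA.
congr (_ + _)%R; first by rewrite addrC subrK.
rewrite [RHS]big_mkcond; apply: eq_bigr => j _.
by rewrite tnthS /bump leq0n add1n ltnS.
Qed.

(** The first step [s - i] of a path from level [i] is encoded by the level
    [s] it reaches. *)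
Lemma level_paths_cons (m i t : nat) :
  set_bij [set x : nat * m.-tuple int | level_paths m x.1 t x.2]
    (level_paths m.+1 i t)
    (fun x => [tuple of (x.1%:Z - i%:Z)%R :: x.2]).
Proof.
split.
- move=> [s k] [ge0 end_t]; split; last by rewrite path_level_cons.
  case=> [_|u]; first by rewrite path_level0.
  by rewrite ltnS path_level_cons; exact: ge0.
- move=> [s k] [s' k'] _ _ /= /(congr1 val) /= [ss' kk'].
  by congr (_, _); [lia|exact: val_inj].
- move=> k; case/tupleP: k => z k [ge0 end_t].
  have [s sE] : exists s : nat, z = (s%:Z - i%:Z)%R.
    have := ge0 1%N isT; rewrite /path_level big_mkcond big_ord_recl /= tnth0.
    rewrite big1 ?addr0 => [iz|//].
    by exists (absz (i%:Z + z)%R); lia.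
  subst z; rewrite path_level_cons in end_t.
  exists (s, k); last by apply: val_inj.
  split=> // u um; have := ge0 u.+1; rewrite path_level_cons; exact.
Qed.

Lemma path_matrix_ge0 (R : realType) (r : nat) (A : int -> 'M[R]_r)
    (A_ge0 : forall k a b, (0 <= A k a b)%R) (m : nat) (k : m.-tuple int) a b :
  (0 <= (\prod_(j < m) A (tnth k j))%R a b)%R.
Proof.
elim/big_rec: _ a => [|j x _ IH] a; first by rewrite mxE.
by rewrite -mulmxE mxE; apply: sumr_ge0 => d _; rewrite mulr_ge0.
Qed.

(** Induction on the first step, through [Q ^ (m + 1) = Q * Q ^ m]. *)
Lemma imx_pow_path (R : realType) (r : nat) (A : int -> 'M[R]_r)
    (A_ge0 : forall k a b, (0 <= A k a b)%R) (M : imx R (state r) (state r))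
    (ME : forall i t a b, M (i, a) (t, b) = (A (t%:Z - i%:Z)%R a b)%:E)
    (m i t : nat) (a c : 'I_r) :
  imx_pow M m (i, a) (t, c) =
  \esum_(k in level_paths m i t) ((\prod_(j < m) A (tnth k j))%R a c)%:E.
Proof.
have M0 : imx_ge0 M by move=> [? ?] [? ?]; rewrite ME lee_fin.
have prod_ge0 := path_matrix_ge0 A_ge0.
elim: m i a => [|m IHm] i a.
  rewrite /= /imx_id xpair_eqE.
  have [<-|it] := eqVneq i t.
    rewrite (_ : level_paths 0 i i = [set [tuple]]).
      by rewrite esum_set1 ?lee_fin// big_ord0 mxE.
    apply/seteqP; split=> k _; rewrite ?(tuple0 k)//.
    by split=> [[|]//|]; rewrite path_level0.
  rewrite (_ : level_paths 0 i t = set0) ?esum_set0//.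
  by rewrite -subset0 => k [_]; rewrite path_level0 => -[/eqP]; rewrite (negPf it).
rewrite imx_powSl// /imx_mul esum_pair; last first.
  by move=> x; rewrite mule_ge0//; exact: imx_pow_ge0.
rewrite (reindex_esum _ _ _ _ (level_paths_cons m i t)).
transitivity (\esum_(s in [set: nat]) \esum_(k in level_paths m s t)
    ((A (s%:Z - i%:Z) *m \prod_(j < m) A (tnth k j))%R a c)%:E).
  apply: eq_esum => s _; rewrite esum_fin; last first.
    by move=> d; rewrite mule_ge0//; exact: imx_pow_ge0.
  under [RHS]eq_esum do rewrite mxE -sumEFin.
  rewrite esum_sum; last by move=> k d _ _; rewrite lee_fin mulr_ge0.
  apply: eq_bigr => d _; rewrite ME IHm -ge0_esumZl ?lee_fin// => k.
  by rewrite lee_fin.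
rewrite esum_esum; last first.
  move=> s k _ _; rewrite lee_fin mxE; apply: sumr_ge0 => d _.
  by rewrite mulr_ge0.
rewrite (_ : _ `*`` _ = [set x | level_paths m x.1 t x.2]); last first.
  by apply/seteqP; split=> [x []//|x xP]; split.
apply: eq_esum => -[s k] _ /=; rewrite big_ord_recl tnth0 mulmxE.
congr (fun_of_matrix (_ * _)%R a c)%:E.
by apply: eq_bigr => j _; rewrite tnthS.
Qed.

Lemma imx_mul_D (R : realType) (r N : nat) (B : nat -> 'M[R]_r)
    (A : int -> 'M[R]_r) (A_ge0 : forall k a b, (0 <= A k a b)%R)
    (E : Type) (M : imx R E (state r)) (x : E) (b : 'I_r) : imx_ge0 M ->
  imx_mul M (D_part N (mg1 B A)) x (ord_max, b) =
  \sum_d M x (0%N, d) * (A (- 1)%R d b)%:E.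
Proof.
move=> M0; rewrite /imx_mul esum_pair; last first.
  move=> [s d]; rewrite mg1_D_block mule_ge0//; case: ifP => // _.
  by rewrite lee_fin.
rewrite (@esum_single _ _ _ 0%N).
- rewrite esum_fin => [|d].
    by apply: eq_bigr => d _; rewrite mg1_D_block !eqxx.
  by rewrite mg1_D_block !eqxx /= mule_ge0// lee_fin.
- by apply: esum_ge0 => d _; rewrite mg1_D_block !eqxx /= mule_ge0// lee_fin.
- move=> s /negPf s0; apply: esum1 => d _.
  by rewrite mg1_D_block s0 /= mule0.
Qed.

(** A path of [level_paths] with a step below -1 has product 0, so that the
    bound on the steps in [path_set] does not change the sum. *)
Lemma imx_pow_D_path (R : realType) (r N : nat) (B : nat -> 'M[R]_r)
    (A : int -> 'M[R]_r) (A_ge0 : forall k a b, (0 <= A k a b)%R)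
    (A_skip_free : forall k : int, (k < - 1)%R -> A k = 0%R)
    (m i : nat) (a b : 'I_r) :
  imx_mul (imx_pow (Q_part N (mg1 B A)) m) (D_part N (mg1 B A))
    (i, a) (ord_max, b) =
  \esum_(k in path_set m i) (path_prod A k a b)%:E.
Proof.
have QE := mg1_Q_block N B A_skip_free.
have Q0 : imx_ge0 (Q_part N (mg1 B A)).
  by move=> [? ?] [? ?]; rewrite QE lee_fin.
rewrite imx_mul_D//; last exact: imx_pow_ge0.
have prod_ge0 := path_matrix_ge0 A_ge0.
transitivity (\esum_(k in level_paths m i 0) (path_prod A k a b)%:E).
  rewrite /path_prod; under [RHS]eq_esum do rewrite mxE -sumEFin.
  rewrite esum_sum; last by move=> k d _ _; rewrite lee_fin mulr_ge0.
  apply: eq_bigr => d _; rewrite (imx_pow_path A_ge0 QE) -ge0_esumZr ?lee_fin// => k.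
  by rewrite lee_fin.
apply: esum_restrict => [k [_ ? ?]//|k [ge0 end0] no].
have [/forallP stepP|] := boolP [forall j, (- 1 <= tnth k j)%R].
  by case: no; split.
rewrite negb_forall => /existsP[j]; rewrite -ltNge => /A_skip_free Aj0.
suff -> : path_prod A k = 0%R by rewrite mxE.
rewrite /path_prod (_ : \prod_(l < m) _ = 0)%R ?mul0mx//.
have : j \in index_enum 'I_m by rewrite mem_index_enum.
elim: (index_enum _) => [//|l s IHs]; rewrite inE big_cons.
by move=> /predU1P[<-|/IHs->]; rewrite ?Aj0 ?mul0r ?mulr0.
Qed.

(** * The rows of the censored matrix sum to 1 *)

Lemma subset_le_esum (R : realType) (T : choiceType) (I J : set T)
    (a : T -> \bar R) : I `<=` J -> (forall x, 0 <= a x) ->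
  \esum_(i in I) a i <= \esum_(i in J) a i.
Proof.
move=> IJ a0; rewrite esum_mkcond [leRHS]esum_mkcond; apply: le_esum => x _.
by case: ifPn => [/set_mem/IJ/mem_set->//|_]; case: ifP.
Qed.

Lemma imx_mulDr (R : realType) (E : Type) (F : choiceType) (G : Type)
    (M : imx R E F) (M' M'' : imx R F G) :
  imx_ge0 M -> imx_ge0 M' -> imx_ge0 M'' ->
  imx_mul M (imx_add M' M'') = imx_add (imx_mul M M') (imx_mul M M'').
Proof.
move=> M0 M'0 M''0; apply/funext => x; apply/funext => z.
rewrite /imx_mul /imx_add -esumD; try by move=> y _; exact: mule_ge0.
by apply: eq_esum => y _; rewrite ge0_muleDr.
Qed.

Lemma low_le (r N : nat) (u : low_state r N) : ((low u).1 <= N)%N.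
Proof. by rewrite -ltnS /= ltn_ord. Qed.

Lemma high_gt (r N : nat) (v : state r) : (N < (high N v).1)%N.
Proof. by rewrite /= addSn ltnS leq_addr. Qed.

Lemma low_inj (r N : nat) : injective (@low r N).
Proof. by move=> [i a] [j b] [/val_inj -> ->]. Qed.

Lemma high_inj (r N : nat) : injective (@high r N).
Proof. by move=> [i a] [j b] [/addnI -> ->]. Qed.

Lemma low_surj (r N : nat) (x : state r) :
  (x.1 <= N)%N -> low (inord x.1 : 'I_N.+1, x.2) = x.
Proof. by case: x => i a iN; rewrite /low /= inordK. Qed.

Lemma high_surj (r N : nat) (x : state r) :
  (N < x.1)%N -> high N ((x.1 - N.+1)%N, x.2) = x.
Proof. by case: x => i a iN; rewrite /high /= subnKC. Qed.

Lemma esum_low_high (R : realType) (r N : nat) (a : state r -> \bar R) :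
  (forall x, 0 <= a x) ->
  \esum_(x in [set: state r]) a x =
  \esum_(u in [set: low_state r N]) a (low u) +
  \esum_(v in [set: state r]) a (high N v).
Proof.
move=> a0; rewrite (esumID [set x : state r | (x.1 <= N)%N])// !setTI.
congr (_ + _); apply: reindex_esum; split=> //=.
- by move=> u _; exact: low_le.
- by move=> u v _ _; exact: low_inj.
- by move=> x xN; exists (inord x.1, x.2) => //; exact: low_surj.
- by move=> v _ /=; apply/negP; rewrite -ltnNge; exact: high_gt.
- by move=> u v _ _; exact: high_inj.
- move=> x /negP; rewrite -ltnNge => xN.
  by exists ((x.1 - N.+1)%N, x.2) => //; exact: high_surj.
Qed.

Lemma le_esum_high (R : realType) (r N : nat) (a : state r -> \bar R)
    (u : low_state r N) : (forall x, 0 <= a x) ->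
  \esum_(v in [set: state r]) a (high N v) <= \esum_(x in [set x | x != low u]) a x.
Proof.
move=> a0; rewrite -(esum_image _ (high N)); last by move=> x y _ _; exact: high_inj.
apply: subset_le_esum => // _ [v _ <-] /=; apply: contraTneq (high_gt N v) => ->.
by rewrite -leqNgt low_le.
Qed.

(** [avoid K n y x] is the probability that the chain started at [x] does not
    visit [y] at the times 1, ..., n. *)
Fixpoint avoid (R : realType) (E : choiceType) (K : imx R E E) (n : nat)
    (y x : E) : \bar R :=
  if n is n'.+1
  then \esum_(z in [set z | z != y]) (K x z * avoid K n' y z)
  else 1.

Lemma avoid_ge0 (R : realType) (E : choiceType) (K : imx R E E) n y x :
  imx_ge0 K -> 0 <= avoid K n y x.
Proof.
move=> K0; elim: n x => [|n IHn] x; first exact: lee01.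
by apply: esum_ge0 => z _; exact: mule_ge0.
Qed.

Lemma first_passage_ge0 (R : realType) (E : choiceType) (K : imx R E E) n :
  imx_ge0 K -> imx_ge0 (first_passage K n).
Proof.
move=> K0; elim: n => [//|n IHn] x y.
by apply: esum_ge0 => z _; rewrite mule_ge0//; exact: IHn.
Qed.

(** Complementary events: no visit to [y] up to time [n], and a first visit at
    one of these times. *)
Lemma avoid_first_passage (R : realType) (E : choiceType) (K : imx R E E) n y x :
  transition_matrix K ->
  avoid K n y x + \sum_(0 <= k < n) first_passage K k x y = 1.
Proof.
move=> [K0 K1]; elim: n x => [|n IHn] x; first by rewrite big_geq// adde0.
rewrite big_nat_recl//= addeCA.
rewrite -(@esum_sum _ _ _ _ (index_iota 0 n) xpredT
  (fun z k => K x z * first_passage K k z y)); last first.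
  by move=> z k _ _; rewrite mule_ge0//; exact: first_passage_ge0.
rewrite -esumD; last first.
- move=> z _; apply: sume_ge0 => k _; rewrite mule_ge0//.
  exact: first_passage_ge0.
- by move=> z _; rewrite mule_ge0// avoid_ge0.
rewrite -[RHS](K1 x) [RHS](esumID [set y])// setTI esum_set1// setTI.
congr (_ + _).
rewrite (_ : [set z | z != y] = [set~ y]); last first.
  by apply/seteqP; split=> z /eqP.
apply: eq_esum => z _.
rewrite -ge0_sume_distrr => [|k _]; last exact: first_passage_ge0.
rewrite -ge0_muleDr ?avoid_ge0// ?IHn ?mule1//.
by apply: sume_ge0 => k _; exact: first_passage_ge0.
Qed.

Section CensoredRows.
Variables (R : realType) (r N : nat) (P : imx R (state r) (state r)).
Hypothesis P_stoch : transition_matrix P.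

Let P0 : imx_ge0 P := P_stoch.1.
Let T := T_part N P.
Let U := U_part N P.
Let D := D_part N P.
Let Q := Q_part N P.

Let one (E : Type) : imx R E unit := fun _ _ => 1.

Let one_ge0 E : imx_ge0 (@one E). Proof. by move=> x y; exact: lee01. Qed.
Let T0 : imx_ge0 T. Proof. by move=> x y; exact: P0. Qed.
Let U0 : imx_ge0 U. Proof. by move=> x y; exact: P0. Qed.
Let D0 : imx_ge0 D. Proof. by move=> x y; exact: P0. Qed.
Let Q0 : imx_ge0 Q. Proof. by move=> x y; exact: P0. Qed.

Let TU1 : imx_add (imx_mul T (@one _)) (imx_mul U (@one _)) = @one _.
Proof.
apply/funext => x; apply/funext => z; rewrite [RHS]/one -[RHS](P_stoch.2 (low x)).
rewrite (esum_low_high N)//; congr (_ + _);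
  by apply: eq_esum => y _; exact: mule1.
Qed.

Let DQ1 : imx_add (imx_mul D (@one _)) (imx_mul Q (@one _)) = @one _.
Proof.
apply/funext => x; apply/funext => z; rewrite [RHS]/one -[RHS](P_stoch.2 (high N x)).
rewrite (esum_low_high N)//; congr (_ + _);
  by apply: eq_esum => y _; exact: mule1.
Qed.

(** After [M.+1] steps from [u] the chain either has come back to the low
    levels, at a time [m.+2 <= M.+1] or at time 1, or is still high. *)
Lemma return_or_high M u :
  imx_mul T (@one _) u tt +
  \sum_(0 <= m < M) imx_mul U (imx_mul (imx_pow Q m) (imx_mul D (@one _))) u tt
  + imx_mul U (imx_mul (imx_pow Q M) (@one _)) u tt = 1.
Proof.
elim: M => [|M IHM].
  rewrite big_geq// adde0 /= imx_mul1l//.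
  exact: (congr1 (fun f => f u tt) TU1).
have D10 : imx_ge0 (imx_mul D (@one _)) by exact: imx_mul_ge0.
have Q10 : imx_ge0 (imx_mul Q (@one _)) by exact: imx_mul_ge0.
have QM0 := @imx_pow_ge0 _ _ _ M Q0.
rewrite -[RHS]IHM big_nat_recr//= -!addeA; congr (_ + (_ + _)).
rewrite -imx_mulA// -[in RHS]DQ1.
by rewrite imx_mulDr// imx_mulDr//; exact: imx_mul_ge0.
Qed.

(** A path that stays high avoids every low state. *)
Lemma high_le_avoid M (u : low_state r N) x :
  \esum_(v in [set: state r])
    (P x (high N v) * imx_mul (imx_pow Q M) (@one _) v tt)
  <= avoid P M.+1 (low u) x.
Proof.
have stay_ge0 m v : 0 <= imx_mul (imx_pow Q m) (@one _) v tt.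
  by apply: imx_mul_ge0 => //; exact: imx_pow_ge0.
have step m : (forall v, imx_mul (imx_pow Q m) (@one _) v tt <=
    avoid P m (low u) (high N v)) -> forall y,
    \esum_(v in [set: state r])
      (P y (high N v) * imx_mul (imx_pow Q m) (@one _) v tt)
    <= avoid P m.+1 (low u) y.
  move=> le_m y.
  apply: le_trans (le_esum_high (a := fun z => P y z * avoid P m (low u) z) u _).
    by apply: le_esum => v _; rewrite lee_wpmul2l.
  by move=> z; rewrite mule_ge0// avoid_ge0.
apply: (step); elim: M => [|M IHM] v.
  by rewrite /= imx_mul1l.
rewrite imx_powSl// -imx_mulA//; last exact: imx_pow_ge0.
exact: step.
Qed.

(** By [return_or_high] the row sum falls short of 1 by the limit of the
    probabilities of being still high, which is 0 since [u] is recurrent. *)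
Lemma censored_transition_matrix :
  (forall x, \sum_(0 <= n <oo) first_passage P n x x = 1) ->
  transition_matrix (imx_add T (imx_mul U (imx_mul (imx_hat Q) D))).
Proof.
move=> rec; have Qh0 := imx_hat_ge0 Q0.
have QhD0 : imx_ge0 (imx_mul (imx_hat Q) D) by exact: imx_mul_ge0.
have UQhD0 : imx_ge0 (imx_mul U (imx_mul (imx_hat Q) D)) by exact: imx_mul_ge0.
have D10 : imx_ge0 (imx_mul D (@one _)) by exact: imx_mul_ge0.
have QD10 m : imx_ge0 (imx_mul (imx_pow Q m) (imx_mul D (@one _))).
  by apply: imx_mul_ge0 => //; exact: imx_pow_ge0.
split=> [x y|u]; first by rewrite adde_ge0//; exact: P0.
rewrite esumD; try by move=> v _; first [exact: P0|exact: UQhD0].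
pose ret m := imx_mul U (imx_mul (imx_pow Q m) (imx_mul D (@one _))) u tt.
have ret_ge0 m : 0 <= ret m by exact: imx_mul_ge0.
pose t := imx_mul T (@one _) u tt.
have t_ge0 : 0 <= t by exact: imx_mul_ge0.
have -> : \esum_(v in [set: low_state r N]) T u v = t.
  by apply: eq_esum => v _; rewrite [RHS]mule1.
have -> : \esum_(v in [set: low_state r N])
    imx_mul U (imx_mul (imx_hat Q) D) u v = \sum_(0 <= m <oo) ret m.
  transitivity (imx_mul (imx_mul U (imx_mul (imx_hat Q) D)) (@one _) u tt).
    by apply: eq_esum => v _; rewrite [RHS]mule1.
  rewrite -imx_mulA// -imx_mulA//.
  rewrite -(imx_mul_seriesr (M' := fun m => _))//; congr imx_mul.
  apply/funext => y; apply/funext => z; rewrite -imx_mul_seriesl//.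
  by move=> m; exact: imx_pow_ge0.
have sum1 M := return_or_high M u.
have high0 M : 0 <= imx_mul U (imx_mul (imx_pow Q M) (@one _)) u tt.
  by apply: imx_mul_ge0 => //; apply: imx_mul_ge0 => //; exact: imx_pow_ge0.
apply/eqP; rewrite eq_le; apply/andP; split.
- have t_fin : t \is a fin_num.
    rewrite ge0_fin_numE//; apply: le_lt_trans (ltry 1).
    by rewrite -[X in _ <= X](sum1 0%N) big_geq// adde0 leeDl.
  rewrite -leeBrDl//; apply: lime_le; first exact: is_cvg_nneseries.
  apply: nearW => M; rewrite leeBrDl//.
  by rewrite -[X in _ <= X](sum1 M) leeDl.
- rewrite -(rec (low u)); apply: lime_le.
    by apply: is_cvg_nneseries => k _ _; exact: first_passage_ge0.
  apply: nearW => M.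
  have avoid1 := avoid_first_passage M (low u) (low u) P_stoch.
  have a0 := avoid_ge0 M (low u) (low u) P0.
  have afin : avoid P M (low u) (low u) \is a fin_num.
    rewrite ge0_fin_numE//; apply: le_lt_trans (ltry 1).
    rewrite -[X in _ <= X]avoid1 leeDl//; apply: sume_ge0 => k _.
    exact: first_passage_ge0.
  rewrite -(leeD2lE _ _ afin) avoid1.
  case: M a0 afin {avoid1} => [|M] a0 afin.
    by rewrite /= leeDl// adde_ge0// nneseries_ge0.
  have hM : imx_mul U (imx_mul (imx_pow Q M) (@one _)) u tt <=
      avoid P M.+1 (low u) (low u) := high_le_avoid M u (low u).
  rewrite -[leLHS](sum1 M) [leRHS]addeC; apply: leeD; last exact: hM.
  by apply: leeD2l; apply: nneseries_lim_ge => m _ _; exact: ret_ge0.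
Qed.

End CensoredRows.

(** * The Markov property at events determined by the past *)

Lemma measure_countable_partition (R : realType) (d : measure_display)
    (Omega : measurableType d) (mu : {measure set Omega -> \bar R})
    (I : countType) (F : set Omega) (G : I -> set Omega) :
  (forall i, measurable (G i)) ->
  (forall i j w, G i w -> G j w -> i = j) ->
  (forall w, F w <-> exists i, G i w) ->
  mu F = \esum_(i in [set: I]) mu (G i).
Proof.
move=> mG disjG FG.
(* Numbers that code no element of [I] carry the empty set. *)
pose H n := if pickle_inv n is Some i then G i else set0 : set Omega.
have mH n : measurable (H n) by rewrite /H; case: pickle_inv.
have HE i : H (pickle i) = G i by rewrite /H pickleK_inv.
have disjH : trivIset setT H.
  move=> n n' _ _ [w []]; rewrite /H.
  have := @pickle_invK I n; have := @pickle_invK I n'.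
  case: (pickle_inv n') => [i' /=|//]; case: (pickle_inv n) => [i /=|//].
  by move=> <- <- Gi Gi'; rewrite (disjG _ _ _ Gi Gi').
have -> : F = \bigcup_n H n.
  apply/seteqP; split=> w.
    by move=> /FG[i Gi]; exists (pickle i) => //; rewrite HE.
  move=> [n _]; rewrite /H; case: pickle_inv => [i Gi|//].
  by apply/FG; exists i.
rewrite measure_semi_bigcup//; last exact: bigcupT_measurable.
rewrite nneseries_esumT//.
rewrite (@esum_restrict _ _ (pickle @` [set: I])); last 2 first.
- by [].
- move=> n _ no; rewrite /H; have := @pickle_invK I n.
  case: (pickle_inv n) => [i /= ni|_]; last exact: measure0.
  by case: no; exists i.
rewrite esum_image; first by apply: eq_esum => i _; rewrite HE.
by move=> i j _ _; apply: (pcan_inj (@pickleK I)).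
Qed.

Lemma countable_union_measurable (d : measure_display)
    (Omega : measurableType d) (I : countType) (F : set Omega)
    (G : I -> set Omega) :
  (forall i, measurable (G i)) -> (forall w, F w <-> exists i, G i w) ->
  measurable F.
Proof.
move=> mG FG; rewrite (_ : F = \bigcup_i G i).
  by apply: countable_bigcupT_measurable => //; exact: countableP.
apply/seteqP; split=> w; first by move=> /FG[i]; exists i.
by move=> [i _ Gi]; apply/FG; exists i.
Qed.

(** Extensional form of being measurable for the process up to time [t]. *)
Definition determined (Omega E : Type) (X : nat -> Omega -> E) (t : nat)
    (F : set Omega) :=
  forall w w', (forall i, (i <= t)%N -> X i w = X i w') -> F w -> F w'.

(** Cells are indexed by tuples, and not by functions on [nat], so that there
    are countably many of them when [E] is countable. *)
Definition cell (Omega E : Type) (X : nat -> Omega -> E) (t : nat)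
    (s : t.+1.-tuple E) : set Omega :=
  [set w | forall i, (i <= t)%N -> X i w = tnth s (inord i)].

Lemma cell_uniq (Omega E : Type) (X : nat -> Omega -> E) (t : nat)
    (s s' : t.+1.-tuple E) w : cell X s w -> cell X s' w -> s = s'.
Proof.
move=> sw s'w; apply: eq_from_tnth => i.
by rewrite -(inord_val i) -sw -?s'w// -ltnS.
Qed.

Lemma cell_exists (Omega E : Type) (X : nat -> Omega -> E) (t : nat) w :
  exists s : t.+1.-tuple E, cell X s w.
Proof.
exists [tuple X (val i) w | i < t.+1] => i it.
by rewrite tnth_mktuple /= inordK.
Qed.

Lemma determined_cell (Omega E : Type) (X : nat -> Omega -> E) (t : nat)
    (F : set Omega) (s : t.+1.-tuple E) : determined X t F ->
  F `&` cell X s = cell X s \/ F `&` cell X s = set0.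
Proof.
move=> detF; have [[w [Fw sw]]|no] := pselect (exists w, F w /\ cell X s w).
  left; apply/seteqP; split=> [w' []//|w' sw']; split=> //.
  by apply: detF Fw => i it; rewrite sw// sw'.
by right; rewrite -subset0 => w [Fw sw]; case: no; exists w.
Qed.

Section MarkovProperty.
Variables (R : realType) (d : measure_display) (Omega : measurableType d).
Variables (Pr : probability Omega R) (E : countType) (K : imx R E E).
Variable X : nat -> Omega -> E.
Hypothesis chain : markov_chain Pr K (fun n w => Some (X n w)).

Let mX n x : measurable [set w | X n w = x].
Proof.
case: chain => _ mX _; rewrite (_ : [set _ | _] = [set w | Some (X n w) = Some x]).
  exact: mX.
by apply/seteqP; split=> w /= [->].
Qed.

Let mcell t (s : t.+1.-tuple E) : measurable (cell X s).
Proof.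
rewrite (_ : cell X s =
    \bigcap_(i in [set i | (i <= t)%N]) [set w | X i w = tnth s (inord i)]).
  by apply: bigcap_measurableType => i _; exact: mX.
by apply/seteqP; split=> w sw i; exact: sw.
Qed.

Lemma measurable_determined t (F : set Omega) :
  determined X t F -> measurable F.
Proof.
move=> detF; apply: (countable_union_measurable (I := t.+1.-tuple E)
    (G := fun s => F `&` cell X s)).
  by move=> s; case: (determined_cell s detF) => ->.
by move=> w; split=> [Fw|[s []//]]; have [s sw] := cell_exists X t w; exists s.
Qed.

(** Each of the countably many cells that make up [F] fixes a trajectory up to
    time [t], ending in [x]: on a cell this is the definition of a chain. *)
Lemma markov_step t (F : set Omega) (x y : E) :
  determined X t F -> (forall w, F w -> X t w = x) ->
  Pr (F `&` [set w | X t.+1 w = y]) = Pr F * K x y.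
Proof.
move=> detF Fx; have mF := measurable_determined detF.
have split_cells (G : set Omega) : measurable G ->
    Pr (F `&` G) = \esum_(s in [set: t.+1.-tuple E]) Pr (F `&` cell X s `&` G).
  move=> mG; apply: measure_countable_partition.
  - by move=> s; apply: measurableI => //; exact: measurableI.
  - by move=> s s' w [[_ sw] _] [[_ s'w] _]; exact: cell_uniq sw s'w.
  - move=> w; split=> [[Fw Gw]|[s [[]]]//].
    by have [s sw] := cell_exists X t w; exists s.
have := split_cells setT measurableT; rewrite setIT => ->.
rewrite split_cells//; have [[K0 _] _ step] := chain.
rewrite -ge0_esumZr//; apply: eq_esum => s _; rewrite setIT.
have [] := determined_cell s detF => FsE; rewrite FsE; last first.
  by rewrite set0I measure0 mul0e.
have [->|/set0P[w sw]] := eqVneq (cell X s) set0.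
  by rewrite set0I measure0 mul0e.
have xE : tnth s (inord t) = x.
  by rewrite -sw//; apply: Fx; move: sw; rewrite -FsE => -[].
(* The trajectory [s] prolonged by [y]. *)
pose x' i := if (i <= t)%N then tnth s (inord i) else y.
have := step t x'; rewrite /x' leqnn ltnn xE => stepE.
rewrite (_ : cell X s `&` _ = [set w0 | forall i, (i <= t.+1)%N ->
    Some (X i w0) = Some (x' i)]).
  rewrite stepE; congr (Pr _ * _); apply/seteqP; split=> v /= sv i it.
    by have := sv i it; rewrite it => -[].
  by rewrite it sv.
apply/seteqP; split=> v /=.
  move=> [sv vy] i; rewrite leq_eqVlt ltnS => /predU1P[->|it].
    by rewrite /x' ltnn vy.
  by rewrite /x' it sv.
move=> sv; split.
  by move=> i it; have := sv i (leqW it); rewrite /x' it => -[].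
by have := sv t.+1 (leqnn _); rewrite /x' ltnn => -[].
Qed.

End MarkovProperty.

(** * Visit times *)

Lemma visit_lt (r N : nat) (z : nat -> state r) (k k' n n' : nat) :
  is_visit N z k n -> is_visit N z k' n' -> (n < n')%N -> (k < k')%N.
Proof.
move=> /andP[zn /eqP <-] /andP[_ /eqP <-] nn'.
rewrite -(subnKC nn') addSnnS iotaD count_cat -addn1 leq_add2l add0n /= zn.
by rewrite leq_addr.
Qed.

Lemma visit_uniq (r N : nat) (z : nat -> state r) (k n n' : nat) :
  is_visit N z k n -> is_visit N z k n' -> n = n'.
Proof.
move=> vn vn'; case: (ltngtP n n') => // nn'.
- by have := visit_lt vn vn' nn'; rewrite ltnn.
- by have := visit_lt vn' vn nn'; rewrite ltnn.
Qed.

Lemma visit_le (r N : nat) (z : nat -> state r) (k k' n n' : nat) :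
  is_visit N z k n -> is_visit N z k' n' -> (k <= k')%N -> (n <= n')%N.
Proof.
move=> vn vn'; apply: contraTT; rewrite -!ltnNge; exact: visit_lt vn' vn.
Qed.

(** The visit at time [t] makes the count of visits [k.+1]; it has to stay so
    until the next visit. *)
Lemma visit_next (r N : nat) (z : nat -> state r) (k t m : nat) :
  is_visit N z k t ->
  is_visit N z k.+1 (t + m.+1) <->
  (forall j, (t < j <= t + m)%N -> (N < (z j).1)%N) /\
  ((z (t + m.+1)%N).1 <= N)%N.
Proof.
move=> /andP[zt /eqP kE].
have countE : count (fun j => (z j).1 <= N)%N (iota 0 (t + m.+1)) =
    (k.+1 + count (fun j => (z j).1 <= N)%N (iota t.+1 m))%N.
  by rewrite iotaD count_cat kE add0n /= zt addnA addn1.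
have highE : (count (fun j => (z j).1 <= N)%N (iota t.+1 m) == 0%N) <->
    forall j, (t < j <= t + m)%N -> (N < (z j).1)%N.
  rewrite -leqn0 leqNgt -has_count; split=> [/hasPn high j tj|high].
    by rewrite ltnNge; apply: high; rewrite mem_iota addSn ltnS.
  apply/hasPn => j; rewrite mem_iota addSn ltnS => tj.
  by rewrite -ltnNge high.
rewrite /is_visit countE -[X in _ == X]addn0 eqn_add2l.
by split=> [/andP[zl /highE high]|[/highE high zl]]; [split|apply/andP; split].
Qed.

Lemma censoredP (r N : nat) (Omega : Type) (X : nat -> Omega -> state r)
    (k : nat) (w : Omega) (u : low_state r N) :
  censored N X k w = Some u <->
  exists n, is_visit N (X ^~ w) k n /\ X n w = low u.
Proof.
rewrite /censored; case: pselect => [vis|novis]; last first.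
  by split=> [//|[n [vn _]]]; case: novis; exists n.
case: ex_minnP => n vn _; have [Xn _] := andP vn; split=> [[<-]|[n' [vn' XE]]].
  by exists n; rewrite low_surj.
rewrite (visit_uniq vn vn') XE; congr Some; case: u {XE} => i a.
by rewrite /low /= inord_val.
Qed.

(** * The censored chain *)

Section CensoredChain.
Variables (R : realType) (r N : nat) (P : imx R (state r) (state r)).
Variables (d : measure_display) (Omega : measurableType d).
Variables (Pr : probability Omega R) (X : nat -> Omega -> state r).
Hypothesis chain : markov_chain Pr P (fun n w => Some (X n w)).

Let T := T_part N P.
Let U := U_part N P.
Let D := D_part N P.
Let Q := Q_part N P.
Let P0 : imx_ge0 P. Proof. by case: chain => -[]. Qed.
Let U0 : imx_ge0 U. Proof. by move=> x y; exact: P0. Qed.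
Let D0 : imx_ge0 D. Proof. by move=> x y; exact: P0. Qed.
Let Q0 : imx_ge0 Q. Proof. by move=> x y; exact: P0. Qed.

Definition stay_high (t m : nat) (F : set Omega) : set Omega :=
  [set w | F w /\ forall j, (t < j <= t + m)%N -> (N < (X j w).1)%N].

Lemma determined_stay_high t m F : determined X t F ->
  determined X (t + m) (stay_high t m F).
Proof.
move=> detF w w' ww' [Fw high]; split.
  by apply: detF Fw => i it; apply: ww'; rewrite (leq_trans it)// leq_addr.
by move=> j /andP[tj jtm]; rewrite -ww'// high ?tj.
Qed.

Lemma determined_step t F x : determined X t F ->
  determined X t.+1 (F `&` [set w | X t.+1 w = x]).
Proof.
move=> detF w w' ww' [Fw Xw]; split; last by rewrite /= -ww'.
by apply: detF Fw => i it; apply: ww'; exact: leqW.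
Qed.

Lemma stay_highS t m F w : stay_high t m.+1 F w <->
  exists y, stay_high t m F w /\ X (t + m).+1 w = high N y.
Proof.
split=> [[Fw high]|[y [[Fw high] Xy]]].
  have Xhigh : (N < (X (t + m).+1 w).1)%N.
    by apply: high; rewrite addnS leqnn ltnS leq_addr.
  exists (((X (t + m).+1 w).1 - N.+1)%N, (X (t + m).+1 w).2).
  rewrite high_surj//; split=> //; split=> // j /andP[tj jm].
  by apply: high; rewrite tj addnS leqW.
split=> // j /andP[tj]; rewrite addnS leq_eqVlt ltnS => /predU1P[->|jm].
  by rewrite Xy high_gt.
by rewrite high// tj.
Qed.

(** One Markov step out of [m] steps in high levels, decomposed according to
    the high state in which these steps end. *)
Lemma stay_high_step t m F (y : state r) : determined X t F ->
  Pr (stay_high t m.+1 F `&` [set w | X (t + m.+1).+1 w = y]) =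
  \esum_(v in [set: state r])
    (Pr (stay_high t m F `&` [set w | X (t + m).+1 w = high N v])
     * P (high N v) y).
Proof.
move=> detF; have detH := determined_stay_high (m := m) detF.
rewrite addnS.
rewrite (@measure_countable_partition _ _ _ _ (state r) _ (fun v =>
    (stay_high t m F `&` [set w | X (t + m).+1 w = high N v]) `&`
    [set w | X (t + m).+2 w = y])).
- apply: eq_esum => v _; apply: (markov_step chain).
    exact: determined_step.
  by move=> w [_ ->].
- move=> v; apply: (measurable_determined chain (t := (t + m).+2)).
  by apply: determined_step; exact: determined_step.
- by move=> v v' w [[_ /= ->] _] [[_ /= /high_inj]].
- move=> w; split=> [[/stay_highS[v [Fw Xv]] Xy]|[v [[Fw Xv] Xy]]].
    by exists v.
  by split=> //; apply/stay_highS; exists v.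
Qed.

Lemma stay_high_high t m F (u : low_state r N) (v : state r) :
  determined X t F -> (forall w, F w -> X t w = low u) ->
  Pr (stay_high t m F `&` [set w | X (t + m).+1 w = high N v]) =
  Pr F * imx_mul U (imx_pow Q m) u v.
Proof.
move=> detF Fu; elim: m v => [|m IHm] v.
  rewrite (imx_mul1r U0) addn0 -(markov_step chain (high N v) detF Fu).
  congr (Pr (_ `&` _)); apply/seteqP; split=> w; first by case.
  by move=> Fw; split=> // j; rewrite addn0; case: ltngtP.
rewrite stay_high_step// (imx_mulA U0 (imx_pow_ge0 m Q0) Q0).
have UQ0 := imx_mul_ge0 U0 (imx_pow_ge0 m Q0).
rewrite -ge0_esumZl//; last by move=> y; rewrite mule_ge0//; exact: Q0.
by apply: eq_esum => y _; rewrite IHm -muleA.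
Qed.

(** The probabilities, from one low state to another, that the next visit to the
    low levels comes after exactly [m] steps spent high. *)
Definition return_mx (m : nat) : imx R (low_state r N) (low_state r N) :=
  if m is m'.+1 then imx_mul U (imx_mul (imx_pow Q m') D) else T.

Lemma stay_high_return t m F (u v : low_state r N) :
  determined X t F -> (forall w, F w -> X t w = low u) ->
  Pr (stay_high t m F `&` [set w | X (t + m).+1 w = low v]) =
  Pr F * return_mx m u v.
Proof.
move=> detF Fu; case: m => [|m].
  rewrite addn0 -(markov_step chain (low v) detF Fu).
  congr (Pr (_ `&` _)); apply/seteqP; split=> w; first by case.
  by move=> Fw; split=> // j; rewrite addn0; case: ltngtP.
rewrite stay_high_step// /= (imx_mulA U0 (imx_pow_ge0 m Q0) D0).
have UQ0 := imx_mul_ge0 U0 (imx_pow_ge0 m Q0).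
rewrite -ge0_esumZl//; last by move=> y; rewrite mule_ge0//; exact: D0.
by apply: eq_esum => y _; rewrite (stay_high_high _ _ detF Fu) -muleA.
Qed.

Lemma esum_return_mx (u v : low_state r N) :
  \esum_(m in [set: nat]) return_mx m u v =
  imx_add T (imx_mul U (imx_mul (imx_hat Q) D)) u v.
Proof.
have QD0 m : imx_ge0 (imx_mul (imx_pow Q m) D).
  by apply: imx_mul_ge0 => //; exact: imx_pow_ge0.
have ret0 m : 0 <= return_mx m u v.
  by case: m => [|m]; [exact: P0|exact: imx_mul_ge0].
rewrite -nneseries_esumT// nneseries_recl// /imx_add; congr (_ + _).
rewrite -(nneseries_addn (f := fun m => return_mx m u v))//.
rewrite (_ : imx_mul (imx_hat Q) D = fun y z =>
    \sum_(0 <= m <oo) imx_mul (imx_pow Q m) D y z).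
  by rewrite imx_mul_seriesr//; apply: eq_eseriesr => m _; rewrite addn1.
apply/funext => y; apply/funext => z; apply: imx_mul_seriesl => // m.
exact: imx_pow_ge0.
Qed.

Let past k (x : nat -> low_state r N) : set Omega :=
  [set w | forall i, (i <= k)%N -> censored N X i w = Some (x i)].

Let past_at k x t : set Omega :=
  past k x `&` [set w | is_visit N (X ^~ w) k t].

Let determined_visit k t : determined X t [set w | is_visit N (X ^~ w) k t].
Proof.
move=> w w' ww'; rewrite /= /is_visit ww'//.
rewrite (@eq_in_count _ _ (fun j => (X j w').1 <= N)%N)// => j.
by rewrite mem_iota add0n => /andP[_ jt]; rewrite ww'// ltnW.
Qed.

(** The visits before the one at time [t] happen before [t], so that the past
    of the censored chain at its [k]-th visit is decided at time [t]. *)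
Let determined_past_at k x t : determined X t (past_at k x t).
Proof.
move=> w w' ww' [pw vw]; have vw' := determined_visit ww' vw.
split=> // i ik; have /censoredP[n [vn Xn]] := pw i ik.
have nt := visit_le vn vw ik.
apply/censoredP; exists n; split; last by rewrite -ww'.
by apply: determined_visit vn => j jn; apply: ww'; exact: leq_trans jn nt.
Qed.

Let mpast_at k x t : measurable (past_at k x t).
Proof.
have detp := @determined_past_at k x t.
exact (measurable_determined chain detp).
Qed.

Let past_sum k x : Pr (past k x) = \esum_(t in [set: nat]) Pr (past_at k x t).
Proof.
apply: measure_countable_partition; first exact: mpast_at.
- by move=> t t' w [_ vt] [_ vt']; exact: visit_uniq vt vt'.
- move=> w; split=> [pw|[t []]//].
  by have /censoredP[t [vt _]] := pw k (leqnn _); exists t.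
Qed.

(** The next visit after time [t] is at time [(t + m).+1] exactly when the
    chain spends [m] steps in high levels and then comes back. *)
Let past_next k x t :
  Pr (past k.+1 x `&` [set w | is_visit N (X ^~ w) k t]) =
  \esum_(m in [set: nat]) Pr (stay_high t m (past_at k x t) `&`
    [set w | X (t + m).+1 w = low (x k.+1)]).
Proof.
apply: measure_countable_partition.
- move=> m; apply: (measurable_determined chain (t := (t + m).+1)).
  by apply: determined_step; apply: determined_stay_high.
- have next_visit m w : (stay_high t m (past_at k x t) `&`
      [set w | X (t + m).+1 w = low (x k.+1)]) w ->
      is_visit N (X ^~ w) k.+1 (t + m.+1).
    move=> [[[_ vt] high] Xm]; apply/(visit_next m vt); split=> //.
    by rewrite addnS Xm low_le.
  move=> m m' w /next_visit vm /next_visit vm'.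
  by have /eqP := visit_uniq vm vm'; rewrite eqn_add2l eqSS => /eqP.
- move=> w; split=> [[pw vt]|[m [[[pw vt] high] Xm]]].
    have /censoredP[n [vn Xn]] := pw k.+1 (leqnn _).
    have tn : (t < n)%N.
      rewrite ltnNge; apply/negP => nt.
      have := visit_le vt vn (leqnSn k); rewrite leq_eqVlt => /predU1P[tn|].
        by case/andP: vt; case/andP: vn; rewrite -tn => _ /eqP -> _; rewrite gtn_eqF.
      by rewrite ltnNge nt.
    have nE : n = (t + (n - t.+1).+1)%N by rewrite -addSnnS subnKC.
    move: vn; rewrite nE => /(visit_next _ vt)[high _].
    exists (n - t.+1)%N; split; last by rewrite /= -addnS -nE.
    by split=> //; split=> // i ik; apply: pw; exact: leqW.
  split=> // i; rewrite leq_eqVlt ltnS => /predU1P[->|]; last exact: pw.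
  apply/censoredP; exists (t + m.+1)%N; split; last by rewrite addnS.
  by apply/(visit_next m vt); split=> //; rewrite addnS Xm low_le.
Qed.

(** The sum over the time [t] of the [k]-th visit and over the number [m] of
    high steps that follow it; the factor for [m] does not depend on [t]. *)
Lemma censored_markov_step k (x : nat -> low_state r N) :
  Pr (past k.+1 x) =
  Pr (past k x) * imx_add T (imx_mul U (imx_mul (imx_hat Q) D)) (x k) (x k.+1).
Proof.
have ret0 m : 0 <= return_mx m (x k) (x k.+1).
  case: m => [|m]; first exact: P0.
  apply: imx_mul_ge0 => //; apply: imx_mul_ge0 => //; exact: imx_pow_ge0.
transitivity (\esum_(t in [set: nat])
    Pr (past k.+1 x `&` [set w | is_visit N (X ^~ w) k t])).
  apply: measure_countable_partition.
  - move=> t; rewrite (_ : _ `&` _ = \bigcup_s (past_at k.+1 x s `&`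
        [set w | is_visit N (X ^~ w) k t])).
      apply: bigcupT_measurable => s; apply: measurableI => //.
      have detv := @determined_visit k t.
      exact (measurable_determined chain detv).
    apply/seteqP; split=> w; last by move=> [s _ [[]]].
    move=> [pw vt]; have /censoredP[s [vs _]] := pw k.+1 (leqnn _).
    by exists s.
  - by move=> t t' w [_ vt] [_ vt']; exact: visit_uniq vt vt'.
  - move=> w; split=> [pw|[t []]//].
    by have /censoredP[t [vt _]] := pw k (leqnSn _); exists t.
rewrite past_sum -ge0_esumZr//; last first.
  by rewrite -esum_return_mx; exact: esum_ge0.
apply: eq_esum => t _; rewrite past_next -esum_return_mx -ge0_esumZl//.
apply: eq_esum => m _; apply: stay_high_return => // w [pw vt].
have /censoredP[n [vn Xn]] := pw k (leqnn _).
by rewrite (visit_uniq vt vn).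
Qed.

Lemma measurable_censored k (u : low_state r N) :
  measurable [set w | censored N X k w = Some u].
Proof.
apply: (countable_union_measurable (I := nat) (G := fun n =>
    [set w | is_visit N (X ^~ w) k n /\ X n w = low u])); last first.
  by move=> w; exact: censoredP.
move=> n; apply: (measurable_determined chain (t := n)).
move=> w w' ww' [vn Xn]; split; last by rewrite -ww'.
exact: determined_visit ww' vn.
Qed.

End CensoredChain.

(** * The censored matrix of a chain of M/G/1 type *)

(** A step lowers the level by at most 1. *)
Lemma path_set_empty (m i : nat) : (m < i)%N -> path_set m i = set0.
Proof.
move=> mi; rewrite -subset0 => k [step _]; rewrite /path_level => end0.
have : (\sum_(j < m) (- 1 : int) <= \sum_(j < m | (j < m)%N) tnth k j)%R.
  rewrite [leRHS](eq_bigl xpredT) => [|j]; last by rewrite ltn_ord.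
  by apply: ler_sum => j _; exact: step.
rewrite sumr_const card_ord; lia.
Qed.

Lemma is_censored_matrix_partition (R : realType) (r N : nat)
    (P : imx R (state r) (state r)) :
  transition_matrix P ->
  (forall x, \sum_(0 <= n <oo) first_passage P n x x = 1) ->
  is_censored_matrix P (imx_add (T_part N P)
    (imx_mul (U_part N P) (imx_mul (imx_hat (Q_part N P)) (D_part N P)))).
Proof.
move=> P_stoch rec d Omega Pr X chain; split.
- exact: censored_transition_matrix.
- exact: measurable_censored chain.
- exact: censored_markov_step chain.
Qed.

Theorem theorem5p1 (R : realType) (r : nat) (r_ge1 : (1 <= r)%N)
    (B : nat -> 'M[R]_r) (A : int -> 'M[R]_r)
    (B_ge0 : forall k a b, (0 <= B k a b)%R)
    (A_ge0 : forall k a b, (0 <= A k a b)%R)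
    (A_skip_free : forall k : int, (k < - 1)%R -> A k = 0%R)
    (P_stochastic : transition_matrix (mg1 B A))
    (P_recurrent : positive_recurrent (mg1 B A))
    (N : nat) :
  let T := T_part N (mg1 B A) in
  let U := U_part N (mg1 B A) in
  let D := D_part N (mg1 B A) in
  let Q := Q_part N (mg1 B A) in
  let QD := fun m => imx_mul (imx_pow Q m) D in
  let QhatD := imx_mul (imx_hat Q) D in
  (* the blocks of Q and D *)
  (forall (i t : nat) (a b : 'I_r), Q (i, a) (t, b) = (A (t%:Z - i%:Z)%R a b)%:E) /\
  (forall (i : nat) (j : 'I_N.+1) (a b : 'I_r),
     D (i, a) (j, b) =
     if (i == 0%N) && (j == ord_max) then (A (- 1)%R a b)%:E else 0) /\
  (* m = 0 *)
  (forall (i : nat) (a b : 'I_r),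
     QD 0%N (i, a) (ord_max, b) = if i == 0%N then (A (- 1)%R a b)%:E else 0) /\
  (* m >= 1 *)
  (forall (m i : nat) (a b : 'I_r), (1 <= m)%N ->
     QD m (i, a) (ord_max, b) =
       \esum_(k in path_set m i) (path_prod A k a b)%:E /\
     ((m < i)%N -> QD m (i, a) (ord_max, b) = 0)) /\
  (forall (i : nat) (a b : 'I_r),
     QhatD (i, a) (ord_max, b) = \sum_(0 <= m <oo) QD m (i, a) (ord_max, b) /\
     QhatD (i, a) (ord_max, b) =
       (if i == 0%N then (A (- 1)%R a b)%:E else 0) +
       \sum_(1 <= m <oo) \esum_(k in path_set m i) (path_prod A k a b)%:E) /\
  is_censored_matrix (mg1 B A) (imx_add T (imx_mul U QhatD)).
Proof.
move=> T U D Q QD QhatD.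
have P0 : imx_ge0 (mg1 B A) by exact: P_stochastic.1.
have D0 : imx_ge0 D by move=> x y; exact: P0.
have Q0 : imx_ge0 Q by move=> x y; exact: P0.
have QD0 m : imx_ge0 (QD m).
  by apply: imx_mul_ge0 => //; exact: imx_pow_ge0.
have QD_path m i a b : QD m (i, a) (ord_max, b) =
    \esum_(k in path_set m i) (path_prod A k a b)%:E.
  exact: imx_pow_D_path.
have QD_0 i a b : QD 0%N (i, a) (ord_max, b) =
    if i == 0%N then (A (- 1)%R a b)%:E else 0.
  by rewrite /QD imx_mul1l// /D mg1_D_block eqxx andbT.
have hatE i a b : QhatD (i, a) (ord_max, b) =
    \sum_(0 <= m <oo) QD m (i, a) (ord_max, b).
  by apply: imx_mul_seriesl => // m; exact: imx_pow_ge0.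
split; first by move=> i t a b; exact: mg1_Q_block.
split; first by move=> i j a b; exact: mg1_D_block.
split=> //; split.
  move=> m i a b _; split=> // mi.
  by rewrite QD_path path_set_empty// esum_set0.
split; last by apply: is_censored_matrix_partition => // x; case: (P_recurrent x).
move=> i a b; split=> //; rewrite hatE nneseries_recl//; last first.
  by move=> m _; exact: QD0.
by rewrite QD_0; congr (_ + _); apply: eq_eseriesr => m _; exact: QD_path.
Qed.
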